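(* Let $G$ be a generator over an alphabet $A$, with sets of locally controllable events $A_{c,i}\subseteq A$ and locally observable events $A_{o,i}\subseteq A$, $i=1,\dots,n$. Let $A_c=\bigcup_i A_{c,i}$, $A_o=\bigcup_i A_{o,i}$, $A_{uc}=A\setminus A_c$. Let $L=L(G)$ and let $K\subseteq L$ be a specification language over $A$. Let $\Sigma_1,\dots,\Sigma_n\subseteq A$ be extensions of the local alphabets $A_{o,1},\dots,A_{o,n}$ such that $A=\bigcup_{i=1}^n(A_{o,i}\cup\Sigma_i)$ and $K$ is separable with respect to $(A_{o,i}\cup\Sigma_i)_{i=1}^n$. Let $\Sigma_{o,i}=\Sigma_i\cap A_o$ and $\Sigma_{c,i}=\Sigma_i\cap A_c$, and assume $(A_{o,i}\cup\Sigma_{o,i})\cap A_c\subseteq A_{c,i}\cup\Sigma_{c,i}$ for all $i$. Let $P_{i+\Sigma_i}\colon A^*\to(A_{o,i}\cup\Sigma_i)^*$ be the projection. Let $R_i$, $i=1,\dots,n$, be languages over $A_{o,i}\cup\Sigma_i$ that are controllable with respect to $P_{i+\Sigma_i}(L)$ and $(A_{o,i}\cup\Sigma_i)\cap A_{uc}$, such that $R=\parallel_{i=1}^n R_i\subseteq K$, and such that (1) either the $R_i$ are normal with respect to $P_{i+\Sigma_i}(L)$ and $A_{o,i}\cup\Sigma_{o,i}$, (2) or the $R_i$ are observable with respect to $P_{i+\Sigma_i}(L)$ and $A_{o,i}\cup\Sigma_{o,i}$, and $A_c\subseteq A_o$. If the languages $R_i$ are synchronously nonconflicting (in particular, if they are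 prefix-closed), then $R=\parallel_{i=1}^n R_i$ is a sublanguage of $K$ that is controllable with respect to $L$ and $A_{uc}$, and coobservable with respect to $L$ and $(A_{o,i}\cup\Sigma_{o,i})_{i=1}^n$.
   Context: An alphabet is a finite nonempty set of events; all languages are assumed regular. A generator $G=(Q,A,f,q_0,Q_m)$ is a deterministic finite automaton with partial transition function $f$; its generated language is $L(G)=\{s\in A^*\mid f(q_0,s)\text{ is defined}\}$, which is prefix-closed. $\overline{L}$ denotes the prefix closure of $L$; $L$ is prefix-closed if $L=\overline L$. For $Y\subseteq X$, the projection $X^*\to Y^*$ is the monoid morphism erasing the events of $X\setminus Y$ and keeping those of $Y$. For $L_i\subseteq X_i^*$, $X=\bigcup_i X_i$, the synchronous product is $\parallel_i L_i=\bigcap_i P_i^{-1}(L_i)\subseteq X^*$, with $P_i\colon X^*\to X_i^*$ the projections. Languages $L_i$ are synchronously nonconflicting if $\overline{\parallel_i L_i}=\parallel_i\overline{L_i}$. $K\subseteq X^*$ is separable with respect to $(X_i)_i$ if $K=\parallel_i P_i(K)$. Let $N\subseteq X^*$ be prefix-closed with $X\subseteq A$, let $X_o\subseteq X$, $P_o\colon X^*\to X_o^*$ the projection, and $M\subseteq N$. - $M$ is controllable with respect to $N$ and $X_{uc}$ if $\overline{M}X_{uc}\cap N\subseteq\overline{M}$. - $M$ is normal with respect to $N$ and $X_o$ (equivalently: and $P_o$) if $\overline{M}=P_o^{-1}P_o(\overline{M})\cap N$. - $M$ is observable with respect to $N$ and $X_o$ (equivalently: and $P_o$) if for all $s\in\overline{M}$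 and $a\in X\cap A_c$, $sa\notin\overline{M}$ and $sa\in N$ imply $P_o^{-1}P_o(s)\{a\}\cap\overline{M}=\emptyset$. Given local observable alphabets $O_i\subseteq A$ and local controllable alphabets $C_i\subseteq A$ with $\bigcup_i C_i=A_c$, a language $M\subseteq L$ is coobservable with respect to $L$ and $(O_i)_{i=1}^n$ if for all $s\in\overline{M}$ and $a\in A_c$ with $sa\in L\setminus\overline{M}$ there is $i$ such that $a\in C_i$ and $Q_i^{-1}(Q_i(s))\{a\}\cap\overline{M}=\emptyset$, where $Q_i\colon A^*\to O_i^*$ is the projection. Here $O_i=A_{o,i}\cup\Sigma_{o,i}$ and the (extended) local controllable alphabets are $C_i=A_{c,i}\cup\Sigma_{c,i}$. *)

(* Defs.v *)
From mathcomp Require Import all_boot.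
From mathcomp Require Import boolp classical_sets.

Set Implicit Arguments.
Unset Strict Implicit.
Unset Printing Implicit Defensive.

Local Open Scope classical_set_scope.

Notation language A := (set (seq A)).

Section Languages.
Variable A : finType.

Record generator := Generator {
  gstate : finType;
  gtrans : gstate -> A -> option gstate;
  ginit : gstate;
  gmarked : {set gstate}
}.

Fixpoint grun (G : generator) (q : gstate G) (s : seq A) : option (gstate G) :=
  if s is a :: s' then obind (fun q' => grun q' s') (gtrans q a) else Some q.

Definition gen_language (G : generator) : language A :=
  [set s | grun (ginit G) s].

Definition marked_language (G : generator) : language A :=
  [set s | exists2 q, grun (ginit G) s = Some q & q \in gmarked G].

Definition regular (M : language A) : Prop :=
  exists G : generator, M = marked_language G.

(* All alphabets are subsets of [A]; a language over [X] is a set of words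
   over [A] that is included in [words X]. *)
Definition words (X : {set A}) : language A := [set s | all (mem X) s].

Definition pclosure (M : language A) : language A :=
  [set s | exists2 t, M t & prefix s t].

Definition prefix_closed (M : language A) : Prop := M = pclosure M.

(* Restricted to [words X], this is the projection X^* -> Y^* for Y \subset X;
   the domain X^* only matters for inverse images. *)
Definition proj (Y : {set A}) (s : seq A) : seq A := [seq a <- s | a \in Y].

(* The inverse image of [M] under the projection X^* -> Y^*. *)
Definition inv_proj (X Y : {set A}) (M : language A) : language A :=
  words X `&` proj Y @^-1` M.

(* M Y, for a language M and a set of events Y. *)
Definition cat_events (M : language A) (Y : {set A}) : language A :=
  [set s | exists t a, [/\ M t, a \in Y & s = rcons t a]].

Section Families.
Variable n : nat.
Implicit Types (X O C : 'I_n -> {set A}) (Ls : 'I_n -> language A).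

(* The first conjunct is only relevant for the empty family. *)
Definition sync X Ls : language A :=
  words (\bigcup_(i < n) X i)%SET `&`
  [set s | forall i,
     inv_proj (\bigcup_(j < n) X j)%SET (X i) (Ls i) s].

Definition sync_nonconflicting X Ls : Prop :=
  pclosure (sync X Ls) = sync X (fun i => pclosure (Ls i)).

Definition separable X (M : language A) : Prop :=
  M = sync X (fun i => proj (X i) @` M).

(* The family [C] is meant to satisfy \bigcup_i C i = Ac. *)
Definition coobservable (Ac : {set A}) C O (L M : language A) : Prop :=
  forall (s : seq A) (a : A),
    pclosure M s -> a \in Ac -> L (rcons s a) -> ~ pclosure M (rcons s a) ->
    exists i, a \in C i /\
      cat_events (inv_proj [set: A]%SET (O i) [set proj (O i) s]) [set a]%SET
        `&` pclosure M = set0.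

End Families.

Definition controllable (N : language A) (Xuc : {set A}) (M : language A) :
    Prop :=
  cat_events (pclosure M) Xuc `&` N `<=` pclosure M.

(* In [normal] and [observable], [X] is the alphabet over which M and N are
   taken, so that inverse projections are formed in X^*. *)
Definition normal (X : {set A}) (N : language A) (Xo : {set A})
    (M : language A) : Prop :=
  pclosure M = inv_proj X Xo (proj Xo @` pclosure M) `&` N.

Definition observable (Ac X : {set A}) (N : language A) (Xo : {set A})
    (M : language A) : Prop :=
  forall (s : seq A) (a : A),
    pclosure M s -> a \in X :&: Ac ->
    ~ pclosure M (rcons s a) -> N (rcons s a) ->
    cat_events (inv_proj X Xo [set proj Xo s]) [set a]%SET
      `&` pclosure M = set0.

End Languages.

(* Main.v *)
Require Import Defs.
From mathcomp Require Import all_boot.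
From mathcomp Require Import boolp classical_sets.

Local Open Scope classical_set_scope.

(** When the local alphabets cover [A], a word lies in a synchronous product as
    soon as all its projections lie in the components.  Nonconflictingness says
    that the prefix closure of the product is the product of the prefix
    closures, so a one-event extension of a word of [pclosure R] can leave
    [pclosure R] only because one of its projections leaves some
    [pclosure (Rs i)], and this can only happen if [X i] contains the event.

    An uncontrollable event is excluded as a cause by the controllability of
    [Rs i]; hence [R] is controllable ([sync_controllable]).  If the event [a]
    is controllable, it belongs to [C i], so supervisor [i] can disable it, and
    has to do so after every word that it cannot distinguish from the current
    one.  This is what observability of [Rs i] provides: two words with the
    same projection to [O i] have projections to [X i] that still agree on
    [O i], because [O i \subset X i] ([sync_coobservable]).

    Normality is the stronger of the two alternatives ([normal_observable]), so
    both reduce to observability. *)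

Section SyncSupervision.
Set Implicit Arguments.
Unset Strict Implicit.
Variable A : finType.
Implicit Types (s t : seq A) (a : A) (M N L : language A) (X Y : {set A}).

Lemma proj_rcons X s a :
  proj X (rcons s a) = if a \in X then rcons (proj X s) a else proj X s.
Proof. by rewrite /proj filter_rcons. Qed.

Lemma proj_sub X Y s : Y \subset X -> proj Y (proj X s) = proj Y s.
Proof.
move=> /fintype.subsetP YX; rewrite /proj -filter_predI; apply: eq_filter => a /=.
by case: (boolP (a \in Y)) => // /YX ->.
Qed.

Lemma words_proj X s : words X (proj X s).
Proof. by rewrite /words /=; apply: filter_all. Qed.

Lemma prefix_proj X s t : prefix s t -> prefix (proj X s) (proj X t).
Proof. by case/prefixP=> u ->; rewrite /proj filter_cat prefix_prefix. Qed.

(** If [s a] were outside [pclosure M] while [t a] is inside, with [s] and [t]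
    indistinguishable, then [s a] and [t a] would be indistinguishable as well,
    and normality would put [s a] into [pclosure M] after all. *)
Lemma normal_observable (Ac X Xo : {set A}) N M :
  normal X N Xo M -> observable Ac X N Xo M.
Proof.
move=> nM s a Ms /setIP[aX _] nMsa Nsa.
rewrite -subset0 => u [[t [b [[_ /= ts] /set1P -> ->]]] Mta].
apply: nMsa; rewrite nM; split=> //; split.
  have [[Xs _] _] : (inv_proj X Xo (proj Xo @` pclosure M) `&` N) s.
    by rewrite -nM.
  by rewrite /words /= all_rcons /= aX.
by exists (rcons t a) => //; rewrite !proj_rcons ts.
Qed.

Section Cover.
Variables (n : nat) (X : 'I_n -> {set A}).
Hypothesis coverX : [set: A]%SET = (\bigcup_(i < n) X i)%SET.
Implicit Types (Rs : 'I_n -> language A).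

Lemma mem_sync Rs s : sync X Rs s <-> forall i, Rs i (proj (X i) s).
Proof.
have ws : words [set: A]%SET s.
  by rewrite /words /=; apply/allP => a _; apply: finset.in_setT.
rewrite /sync /inv_proj -coverX.
split=> [[_ Rss] i | Rss]; first by case: (Rss i).
by split=> // i; split=> //; apply: Rss.
Qed.

Lemma sync_prefix_closed Rs :
  (forall i, prefix_closed (Rs i)) -> prefix_closed (sync X Rs).
Proof.
move=> pR; rewrite /prefix_closed eqEsubset; split=> s.
  by move=> Rss; exists s => //; apply: prefix_refl.
case=> t /mem_sync Rt st; apply/mem_sync => i; rewrite pR.
by exists (proj (X i) t) => //; apply: prefix_proj.
Qed.

Lemma prefix_closed_sync_nonconflicting Rs :
  (forall i, prefix_closed (Rs i)) -> sync_nonconflicting X Rs.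
Proof.
move=> pR; rewrite /sync_nonconflicting -(sync_prefix_closed pR).
by congr sync; apply: funext => i; apply: pR.
Qed.

Lemma pclosure_syncE Rs s : sync_nonconflicting X Rs ->
  pclosure (sync X Rs) s <-> forall i, pclosure (Rs i) (proj (X i) s).
Proof. by move=> ->; apply: mem_sync. Qed.

Lemma sync_controllable Rs L (Auc : {set A}) :
  sync_nonconflicting X Rs ->
  (forall i, controllable (proj (X i) @` L) (X i :&: Auc) (Rs i)) ->
  controllable L Auc (sync X Rs).
Proof.
move=> ncR ctrlR _ [[s [a [/(pclosure_syncE _ ncR) Rs_s aAuc ->]]] Lsa].
apply/(pclosure_syncE _ ncR) => i.
have := erefl (proj (X i) (rcons s a)); rewrite {2}proj_rcons.
case: ifP => aX projE; last by rewrite projE.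
apply: (ctrlR i); split; last by exists (rcons s a).
by exists (proj (X i) s), a; rewrite inE aX; split.
Qed.

(** The component whose projection leaves its closure at [s a] names the
    supervisor that disables [a]; the event belongs to its alphabet because
    projection would erase it otherwise. *)
Lemma sync_coobservable Rs L (Ac : {set A}) (C O : 'I_n -> {set A}) :
  sync_nonconflicting X Rs ->
  (forall i, O i \subset X i) -> (forall i, X i :&: Ac \subset C i) ->
  (forall i, observable Ac (X i) (proj (X i) @` L) (O i) (Rs i)) ->
  coobservable Ac C O L (sync X Rs).
Proof.
move=> ncR OX XC obsR s a /(pclosure_syncE _ ncR) Rs_s aAc Lsa nRsa.
have [i nRi] : exists i, ~ pclosure (Rs i) (proj (X i) (rcons s a)).
  by apply/existsNP => Rsa; apply/nRsa/(pclosure_syncE _ ncR).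
have aX : a \in X i.
  by apply/negPn/negP => aNX; apply: nRi; rewrite proj_rcons (negPf aNX).
have aXAc : a \in X i :&: Ac by rewrite inE aX.
have projE t : proj (X i) (rcons t a) = rcons (proj (X i) t) a.
  by rewrite proj_rcons aX.
exists i; split; first by apply: (fintype.subsetP (XC i)).
rewrite projE in nRi.
have Nsa : (proj (X i) @` L) (rcons (proj (X i) s) a).
  by exists (rcons s a).
have /= obs0 := obsR i _ _ (Rs_s i) aXAc nRi Nsa.
rewrite -subset0 => _ [[t [b [[_ /= ts] /set1P -> ->]]]].
move=> /(pclosure_syncE _ ncR)/(_ i); rewrite projE => Rta.
suff: (set0 : language A) (rcons (proj (X i) t) a) by [].
rewrite -obs0; split; last exact: Rta.
exists (proj (X i) t), a; split=> //; last exact: set11.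
by split; [apply: words_proj | rewrite /= !proj_sub].
Qed.

End Cover.
End SyncSupervision.

Theorem theorem7 (A : finType) (n : nat) (G : generator A)
    (Aci Aoi Sigma : 'I_n -> {set A}) (K : language A)
    (Rs : 'I_n -> language A) :
  let Ac : {set A} := (\bigcup_(i < n) Aci i)%SET in
  let Ao : {set A} := (\bigcup_(i < n) Aoi i)%SET in
  let Auc : {set A} := ~: Ac in
  let L : language A := gen_language G in
  let X (i : 'I_n) : {set A} := Aoi i :|: Sigma i in
  let O (i : 'I_n) : {set A} := Aoi i :|: (Sigma i :&: Ao) in
  let C (i : 'I_n) : {set A} := Aci i :|: (Sigma i :&: Ac) in
  let PL (i : 'I_n) : language A := proj (X i) @` L in
  let R : language A := sync X Rs in
  0 < #|A| ->
  regular K ->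
  K `<=` L ->
  [set: A]%SET = (\bigcup_(i < n) X i)%SET ->
  separable X K ->
  (forall i, O i :&: Ac \subset C i) ->
  (forall i, regular (Rs i)) ->
  (forall i, Rs i `<=` words (X i)) ->
  (forall i, Rs i `<=` PL i) ->
  (forall i, controllable (PL i) (X i :&: Auc) (Rs i)) ->
  R `<=` K ->
  (forall i, normal (X i) (PL i) (O i) (Rs i)) \/
    ((forall i, observable Ac (X i) (PL i) (O i) (Rs i)) /\ Ac \subset Ao) ->
  ((forall i, prefix_closed (Rs i)) -> sync_nonconflicting X Rs) /\
  (sync_nonconflicting X Rs ->
    [/\ R `<=` K, controllable L Auc R & coobservable Ac C O L R]).
Proof.
move=> Ac Ao Auc L X O C PL R _ _ _ coverX _ OC _ _ _ ctrlR RK obsR.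
split; first exact: prefix_closed_sync_nonconflicting.
move=> ncR; split=> //; first exact: sync_controllable.
apply: sync_coobservable => // i.
- by apply: finset.setUS; apply: finset.subsetIl.
  (* A controllable event of [Sigma i] is in [C i] by definition; one of
     [Aoi i] is in [O i], and therefore in [C i]. *)
- rewrite finset.setIUl finset.subUset; apply/andP; split; last exact: finset.subsetUr.
  by apply: fintype.subset_trans (OC i); apply: finset.setSI; apply: finset.subsetUl.
- by case: obsR => [nR | [oR _]]; [apply: normal_observable | apply: oR].
Qed.
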